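(* Let $p>0$ and let $r\ge 0$ be an integer. Consider the variance function of the LM class, $V_p(m)=\frac{m}{\left(1-\frac{m}{p}\right)^{r}}$ on $M=(0,p)$. Let $\psi_p$ and $\phi_p$ be the primitives on $(0,p)$ of $\frac{1}{V_p(m)}$ and $\frac{m}{V_p(m)}$, respectively, which fulfill the conditions $$\lim_{m\to 0^+}\phi_p'(m)=1,\qquad \lim_{m\to 0^+} m\exp\big(-\psi_p(m)\big)=p,\qquad \lim_{m\to 0^+}\phi_p(m)=0,$$ and put $G_p(m)=m\exp(-\psi_p(m))$. Then for all $m\in(0,p)$, $$\psi_p(m)=\log\frac{m}{p}+\sum_{i=1}^{r}(-1)^i\frac1i\binom{r}{i}\left(\frac mp\right)^{i},$$ $$\phi_p(m)=\frac{p}{r+1}\left(1-\left(1-\frac mp\right)^{r+1}\right),$$ $$G_p(m)=p\,\exp\left(-\sum_{i=1}^{r}(-1)^i\frac1i\binom{r}{i}\left(\frac mp\right)^{i}\right).$$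
   Context: An empty sum (the case $r=0$) equals $0$. A primitive of a function $f$ on an interval is a differentiable function $F$ with $F'=f$ there. *)

(* Defs.v *)
From HB Require Import structures.
From mathcomp Require Import all_boot all_order all_algebra.
From mathcomp Require Import all_classical all_reals all_analysis.

Set Implicit Arguments.
Unset Strict Implicit.
Unset Printing Implicit Defensive.

Import Order.TTheory GRing.Theory Num.Theory.
Import numFieldNormedType.Exports.

Local Open Scope classical_set_scope.
Local Open Scope ring_scope.

Definition LM_variance (R : realType) (p : R) (r : nat) (m : R) : R :=
  m / (1 - m / p) ^+ r.

(* Functions on ]a, b[ are represented by functions on R whose values outside
   ]a, b[ are unconstrained. *)
Definition primitive_on (R : realType) (a b : R) (f F : R -> R) : Prop :=
  forall x : R, a < x < b -> derivable F x 1 /\ derive1 F x = f x.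

Definition LM_G (R : realType) (psi : R -> R) (m : R) : R :=
  m * expR (- psi m).

(* Main.v *)
(* Two primitives on an interval differ by a constant, so it suffices to check
   that the explicit formulas are primitives and to determine the constants at
   0+. For psi this is done on m exp(- psi m), where the logarithmic singularity
   cancels: if psi m = ln m + S m + k with S 0 = 0, its limit is exp(- k). *)
Require Import Defs.
From mathcomp Require Import ring.
From HB Require Import structures.
From mathcomp Require Import all_boot all_order all_algebra.
From mathcomp Require Import all_classical all_reals all_analysis.

Set Implicit Arguments.
Unset Strict Implicit.
Unset Printing Implicit Defensive.

Import Order.TTheory GRing.Theory Num.Theory.
Import numFieldNormedType.Exports.

Local Open Scope classical_set_scope.
Local Open Scope ring_scope.

(** The mean value theorem on the segment between [x] and [y], which lies inside ]a, b[, where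
    [F - H] has derivative 0. *)
Lemma primitive_on_eq_const (R : realType) (a b : R) (f F H : R -> R) (x y : R) :
  primitive_on a b f F -> primitive_on a b f H ->
  a < x < b -> a < y < b -> F x - H x = F y - H y.
Proof.
move=> FP HP; wlog xy : x y / x <= y.
  move=> h xab yab; case: (leP x y) => [xy|/ltW yx]; first exact: h.
  by rewrite (h y x).
move=> /andP[ax _] /andP[_ yb].
have dFH z : z \in `[x, y]%R -> is_derive z 1 (F - H) 0.
  rewrite in_itv/= => /andP[xz zy].
  have zab : a < z < b by rewrite (lt_le_trans ax xz) (le_lt_trans zy yb).
  have [/derivableP dF] := FP z zab; have [/derivableP dH] := HP z zab.
  rewrite !derive1E => Hf Ff.
  by apply: is_derive_eq; rewrite Ff Hf subrr.
pose zero := fun _ : R => 0 : R.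
have dFHoo z : z \in `]x, y[%R -> is_derive z 1 (F - H) (zero z).
  by rewrite in_itv/= => /andP[xz zy]; apply: dFH;
     rewrite in_itv/= (ltW xz) (ltW zy).
have cFH : {within `[x, y], continuous (F - H)}.
  by apply: derivable_within_continuous => z /dFH[].
have [z _] := @MVT_segment R (F - H) zero x y xy dFHoo cFH.
by rewrite /zero mul0r => /subr0_eq/esym.
Qed.

(** A right limit at [a] only sees values on ]a, b[, so identities known only on the open interval
    still determine the constants of integration. *)
Lemma cvg_at_right_eq_oo (R : realType) (a b l k : R) (f g : R -> R) :
  a < b -> (forall x, a < x < b -> f x = g x) ->
  f x @[x --> a^'+] --> l -> g x @[x --> a^'+] --> k -> l = k.
Proof.
move=> ab fg fl gk.
have fk : f x @[x --> a^'+] --> k.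
  apply: cvg_trans gk; apply: near_eq_cvg; near=> x.
  by rewrite fg//; apply/andP; split; near: x;
    [exact: nbhs_right_gt|exact: nbhs_right_lt].
exact: cvg_unique fl fk.
Unshelve. all: by end_near. Qed.

Lemma horner_cvg_at_right (R : realType) (q : {poly R}) (a : R) :
  q.[x] @[x --> a^'+] --> q.[a].
Proof. by apply: cvg_at_right_filter; exact: continuous_horner. Qed.

(** The sum in the formula for psi. As a polynomial in m it has a formal derivative, and its limit
    at 0+ is its value at 0. *)
Definition LM_poly (R : realType) (p : R) (r : nat) : {poly R} :=
  \sum_(1 <= i < r.+1)
    ((-1) ^+ i * (1 / i%:R) * 'C(r, i)%:R * p^-1 ^+ i) *: 'X^i.

Lemma horner_LM_poly (R : realType) (p : R) (r : nat) (x : R) :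
  (LM_poly p r).[x] = \sum_(1 <= i < r.+1)
    (-1) ^+ i * (1 / i%:R) * 'C(r, i)%:R * (x / p) ^+ i.
Proof.
rewrite /LM_poly horner_sum; apply: eq_bigr => i _.
by rewrite hornerZ hornerXn exprMn [x ^+ i * _]mulrC !mulrA.
Qed.

Lemma horner_LM_poly0 (R : realType) (p : R) (r : nat) : (LM_poly p r).[0] = 0.
Proof.
rewrite horner_LM_poly big_nat big1// => i /andP[i_gt0 _].
by rewrite mul0r expr0n gtn_eqF// mulr0.
Qed.

(* The factor 1/i cancels against the derivative of x^i, leaving the binomial
   expansion of (1 - x/p)^r without its constant term. *)
Lemma deriv_LM_poly (R : realType) (p : R) (r : nat) (x : R) :
  x * (LM_poly p r)^`().[x] = (1 - x / p) ^+ r - 1.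
Proof.
rewrite exprBn big_ord_recl/= bin0 !expr0 expr1n !mulr1 mulr1n addrC addKr.
rewrite /LM_poly (big_morph _ (@derivD R) (deriv0 R)) horner_sum mulr_sumr.
(* Shifting the index by one aligns the sum with the tail of the binomial expansion, whose index is
   [bump 0 i], that is i + 1. *)
rewrite big_add1 big_mkord succnK.
apply: eq_bigr => i _.
rewrite derivZ derivXn hornerZ hornerMn hornerXn /bump leq0n add1n.
rewrite expr1n mulr1 -[x ^+ _ *+ _]mulr_natr -[_ * _ *+ _]mulr_natr.
rewrite exprMn [x ^+ i.+1]exprS.
rewrite [i.+1.-1]succnK.
have i0 : i.+1%:R != 0 :> R by rewrite pnatr_eq0.
by field.
Qed.

(** 1/V splits as 1/x + ((1 - x/p)^r - 1)/x: the logarithm accounts for the first term, [LM_poly]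
    for the second. *)
Lemma LM_psi_primitive (R : realType) (p : R) (r : nat) :
  0 < p ->
  primitive_on 0 p (fun m => 1 / LM_variance p r m)
    (fun m => ln m + (LM_poly p r).[m]).
Proof.
move=> p_gt0 x /andP[x_gt0 xp].
have dln : is_derive x 1 (@ln R) x^-1 by exact: is_derive1_ln.
have d : is_derive x 1 (fun m => ln m + (LM_poly p r).[m])
  (x^-1 + (LM_poly p r)^`().[x]) by exact: is_deriveD.
split; first by have [] := d.
rewrite derive1E; have [_ ->] := d.
have -> : (LM_poly p r)^`().[x] = ((1 - x / p) ^+ r - 1) / x.
  by rewrite -deriv_LM_poly mulrC mulKf// gt_eqF.
by rewrite /LM_variance div1r invf_div mulrBl div1r addrC subrK.
Qed.

(** The antiderivative of m/V = (1 - m/p)^r that vanishes at 0. *)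
Definition LM_phi_poly (R : realType) (p : R) (r : nat) : {poly R} :=
  (p / r.+1%:R) *: (1 - (1 - p^-1 *: 'X) ^+ r.+1).

Lemma horner_LM_phi_poly (R : realType) (p : R) (r : nat) (x : R) :
  (LM_phi_poly p r).[x] = p / r.+1%:R * (1 - (1 - x / p) ^+ r.+1).
Proof. by rewrite /LM_phi_poly !hornerE [p^-1 * x]mulrC. Qed.

Lemma LM_phi_primitive (R : realType) (p : R) (r : nat) :
  0 < p ->
  primitive_on 0 p (fun m => m / LM_variance p r m) (horner (LM_phi_poly p r)).
Proof.
move=> p_gt0 x /andP[x_gt0 xp]; split; first exact: derivable_horner.
have x_neq0 : x != 0 by rewrite gt_eqF.
have p_neq0 : p != 0 by rewrite gt_eqF.
have r_neq0 : r.+1%:R != 0 :> R by rewrite pnatr_eq0.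
rewrite derive1E derive_val /LM_phi_poly /LM_variance.
rewrite derivZ derivB derivC deriv_exp derivB derivC derivZ derivX.
rewrite succnK !hornerE hornerMn !hornerE.
rewrite invf_div mulrCA divff// mulr1 [p^-1 * x]mulrC.
rewrite mulNr mulNrn opprK -[_ * _ *+ _]mulr_natr.
by move: r.+1%:R r_neq0 ((1 - x / p) ^+ r) => n n_neq0 y; field; apply/andP.
Qed.

Theorem proposition8 (R : realType) (p : R) (r : nat) (psi phi : R -> R)
    (p_gt0 : 0 < p)
    (psi_prim : primitive_on 0 p (fun m => 1 / LM_variance p r m) psi)
    (phi_prim : primitive_on 0 p (fun m => m / LM_variance p r m) phi)
    (phi'_lim : derive1 phi m @[m --> 0^'+] --> (1 : R))
    (psi_lim : m * expR (- psi m) @[m --> 0^'+] --> p)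
    (phi_lim : phi m @[m --> 0^'+] --> (0 : R)) :
  forall m : R, 0 < m < p ->
    [/\ psi m = ln (m / p)
          + \sum_(1 <= i < r.+1)
              (-1) ^+ i * (1 / i%:R) * 'C(r, i)%:R * (m / p) ^+ i,
        phi m = p / r.+1%:R * (1 - (1 - m / p) ^+ r.+1)
      & LM_G psi m
        = p * expR (- \sum_(1 <= i < r.+1)
              (-1) ^+ i * (1 / i%:R) * 'C(r, i)%:R * (m / p) ^+ i)].
Proof.
have psiE m : 0 < m < p -> psi m = ln (m / p) + (LM_poly p r).[m].
  move=> mp; have /andP[m_gt0 _] := mp.
  (* The point m itself serves as the reference point for the constant of integration. *)
  pose k := psi m - (ln m + (LM_poly p r).[m]).
  have psi_k x : 0 < x < p -> psi x = ln x + (LM_poly p r).[x] + k.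
    move=> xp; apply/eqP; rewrite addrC -subr_eq; apply/eqP.
    exact: primitive_on_eq_const psi_prim (LM_psi_primitive r p_gt0) xp mp.
  have pE : p = expR (- (LM_poly p r).[0] - k).
    have Glim : expR (- (LM_poly p r).[x] - k) @[x --> 0^'+]
        --> expR (- (LM_poly p r).[0] - k).
      apply: continuous_cvg; first exact: continuous_expR.
      apply: cvgB; last exact: cvg_cst.
      by apply: cvgN; exact: horner_cvg_at_right.
    apply: (cvg_at_right_eq_oo p_gt0 _ psi_lim Glim).
    move=> x xp; have /andP[x_gt0 _] := xp.
    rewrite psi_k// -addrA opprD expRD expRN lnK ?posrE// mulVKf ?gt_eqF//.
    by rewrite opprD.
  (* Taking logarithms in [pE] gives ln p = - k, so the constant k is absorbed into ln (m / p). *)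
  rewrite psi_k// ln_div ?posrE// [in ln p]pE expRK horner_LM_poly0.
  by rewrite oppr0 add0r opprK addrAC.
move=> m mp; have /andP[m_gt0 _] := mp.
rewrite -horner_LM_poly; split.
- exact: psiE.
- have phi_k x : 0 < x < p ->
    phi x = (LM_phi_poly p r).[x] + (phi m - (LM_phi_poly p r).[m]).
    move=> xp; apply/eqP; rewrite addrC -subr_eq; apply/eqP.
    exact: primitive_on_eq_const phi_prim (LM_phi_primitive r p_gt0) xp mp.
  have Plim : (LM_phi_poly p r).[x] + (phi m - (LM_phi_poly p r).[m])
      @[x --> 0^'+] --> (LM_phi_poly p r).[0] + (phi m - (LM_phi_poly p r).[m]).
    by apply: cvgD; [exact: horner_cvg_at_right|exact: cvg_cst].
  (* Since [LM_phi_poly] vanishes at 0, the condition on phi at 0+ forces the constant to be 0. *)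
  have := cvg_at_right_eq_oo p_gt0 phi_k phi_lim Plim.
  rewrite [(LM_phi_poly p r).[0]]horner_LM_phi_poly mul0r subr0 expr1n subrr.
  by rewrite mulr0 add0r => /esym/subr0_eq; rewrite horner_LM_phi_poly.
(* The logarithmic part of psi contributes the factor p / m, which turns the leading m into p. *)
- rewrite /LM_G psiE// opprD expRD expRN lnK ?posrE ?divr_gt0//.
  by rewrite invf_div mulrA mulrCA divff ?gt_eqF// mulr1.
Qed.
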